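(* Consider a graph $G=(V=[n],E)$ and a matrix $M\in\mathcal{C}(G)$ with $\mathrm{corank}\, M=d$. Let $P\in\mathbb{R}^{n\times d}$ be a matrix whose columns form an orthonormal basis of $\mathrm{Ker}\, M$ and let $\{p_1,\ldots,p_n\}$ denote the row vectors of $P$ (viewed as column vectors in $\mathbb{R}^d$). The following assertions are equivalent: (i) $M$ satisfies the Strong Arnold Property. (ii) $PP^{T}$ is an extreme point of the spectrahedron $\{X\in\mathcal{S}^n: X\succeq 0,\ \langle E_{ij},X\rangle=p_i^{T}p_j \text{ for } \{i,j\}\in V\cup E\}$. (iii) For any matrix $R\in\mathcal{S}^d$ the following holds: if $p_i^{T}Rp_j=0$ for all $\{i,j\}\in V\cup E$, then $R=0$.
   Context: $\mathcal{S}^n$ is the space of real symmetric $n\times n$ matrices with trace inner product $\langle X,Y\rangle=\mathrm{Tr}(XY)$; $X\succeq 0$ means positive semidefinite; the corank of a matrix is the dimension of its kernel. $E_{ij}=(e_ie_j^{T}+e_je_i^{T})/2$, where $e_1,\ldots,e_n$ are the standard unit vectors, so $\langle E_{ij},X\rangle=X_{ij}$. The node set $V=[n]$ is identified with the set of diagonal pairs $\{i,i\}$, $i\in V$, and $\overline{E}$ is the set of pairs $\{i,j\}$ with $i\ne j$ and $\{i,j\}\notin E$. The linear space $\mathcal{C}(G)$ is $\{X\in\mathcal{S}^n:\langle E_{ij},X\rangle=0\ \forall \{i,j\}\in\overline{E}\}$. For $M\in\mathcal{S}^n$ of rank $r$ with spectral decomposition $M=Q\Lambda Q^{T}$ ($Q$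 orthogonal, $\Lambda$ diagonal with $\Lambda_{ii}\neq 0$ exactly for $i\in[r]$), the tangent space at $M$ to the manifold of symmetric $n\times n$ matrices of rank $r$ is $$\mathcal{T}_M=\left\{Q\begin{pmatrix}U&W\\ W^{T}&0\end{pmatrix}Q^{T}: U\in\mathcal{S}^r,\ W\in\mathbb{R}^{r\times(n-r)}\right\}.$$ A matrix $M\in\mathcal{C}(G)$ satisfies the Strong Arnold Property (SAP) if $\mathcal{T}_M+\mathrm{lin}\{E_{ij}:\{i,j\}\in V\cup E\}=\mathcal{S}^n$, where $\mathrm{lin}$ denotes linear span. *)

(* Defs.v *)
From mathcomp Require Import all_boot all_order all_algebra.
From mathcomp Require Import boolp classical_sets reals.

Set Implicit Arguments.
Unset Strict Implicit.
Unset Printing Implicit Defensive.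

Import Order.TTheory GRing.Theory Num.Theory.

Local Open Scope classical_set_scope.
Local Open Scope ring_scope.

(* A graph on [n] is a symmetric irreflexive relation E on 'I_n. *)

Section Definitions.
Context {R : realType}.

Definition symm n : set 'M[R]_n := [set X | X^T = X].

Definition mxinner n (X Y : 'M[R]_n) : R := \tr (X *m Y).

Definition psdmx n (X : 'M[R]_n) : Prop :=
  X^T = X /\ forall x : 'cV[R]_n, 0 <= (x^T *m X *m x) 0 0.

(* The column x lies in Ker M iff the row x^T lies in kermx M^T, since kermx
   is the left (row) kernel. *)
Definition corank n (M : 'M[R]_n) : nat := \rank (kermx M^T).

Definition cols_orthonormal_basis_of_ker n d (M : 'M[R]_n) (P : 'M[R]_(n, d)) :
  Prop := P^T *m P = 1%:M /\ (P^T == kermx M^T)%MS.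

Definition Emx n (i j : 'I_n) : 'M[R]_n :=
  2^-1 *: (delta_mx i j + delta_mx j i).

Definition VE n (E : rel 'I_n) (i j : 'I_n) : bool := (i == j) || E i j.

Definition nonedge n (E : rel 'I_n) (i j : 'I_n) : bool := (i != j) && ~~ E i j.

Definition CG n (E : rel 'I_n) : set 'M[R]_n :=
  [set X | symm X /\ forall i j, nonedge E i j -> mxinner (Emx i j) X = 0].

Definition spectral_decomposition n (M Q L : 'M[R]_n) : Prop :=
  [/\ Q^T *m Q = 1%:M,
      is_diag_mx L,
      forall i : 'I_n, (L i i != 0) = (i < \rank M)%N
    & M = Q *m L *m Q^T].

(* The matrix with blocks U, W, W^T, 0, its size r + (n - r) cast to n. *)
Definition tangent_block n r (le_r_n : (r <= n)%N)
    (U : 'M[R]_r) (W : 'M[R]_(r, n - r)) : 'M[R]_n :=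
  castmx (subnKC le_r_n, subnKC le_r_n) (block_mx U W W^T 0).

(* All spectral decompositions of M yield the same set of matrices
   Q *m tangent_block _ U W *m Q^T, so quantifying Q existentially just
   amounts to fixing one of them. *)
Definition tangent_space n (M : 'M[R]_n) : set 'M[R]_n :=
  [set Y | exists Q L : 'M[R]_n, spectral_decomposition M Q L /\
     exists (U : 'M[R]_(\rank M)) (W : 'M[R]_(\rank M, n - \rank M)),
       symm U /\ Y = Q *m tangent_block (rank_leq_row M) U W *m Q^T].

Definition lin_VE n (E : rel 'I_n) : {vspace 'M[R]_n} :=
  <<[seq Emx ij.1 ij.2 | ij <- enum [pred ij : 'I_n * 'I_n | VE E ij.1 ij.2]]>>%VS.

Definition SAP n (E : rel 'I_n) (M : 'M[R]_n) : Prop :=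
  [set Y + Z | Y in tangent_space M & Z in [set Z | Z \in lin_VE E]] = @symm n.

Definition extreme_point (V : lmodType R) (K : set V) (x : V) : Prop :=
  K x /\ forall (y z : V) (t : R), K y -> K z -> 0 < t < 1 ->
    x = t *: y + (1 - t) *: z -> y = x /\ z = x.

Definition rowvec n d (P : 'M[R]_(n, d)) (i : 'I_n) : 'cV[R]_d := (row i P)^T.

Definition spectrahedron n d (E : rel 'I_n) (P : 'M[R]_(n, d)) : set 'M[R]_n :=
  [set X | psdmx X /\ forall i j, VE E i j ->
     mxinner (Emx i j) X = ((rowvec P i)^T *m rowvec P j) 0 0].

End Definitions.

(* Main.v *)
(** By the real spectral theorem the tangent space at [M] is
    [{Y symmetric | P^T Y P = 0}].  Its orthogonal complement consists of the
    matrices [P S P^T] with [S] symmetric, and (iii) says that no nonzero such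
    matrix is orthogonal to [lin_VE E]; this is the duality (i) <-> (iii).
    For (ii) <-> (iii): if [P P^T] is a proper convex combination of psd
    matrices [Y] and [Z], both vanish on [Ker P^T], so [Y = P (1 + S) P^T] for
    some symmetric [S]; conversely [P (1 +- e S) P^T] is psd for small [e]. *)
From HB Require Import structures.
Require Import Defs.
From mathcomp Require Import all_boot all_order all_fingroup all_algebra.
From mathcomp Require Import boolp classical_sets reals.
From mathcomp Require Import complex.
From mathcomp Require Import ring lra.

Set Implicit Arguments.
Unset Strict Implicit.
Unset Printing Implicit Defensive.

Import Order.TTheory GRing.Theory Num.Theory.

Local Open Scope ring_scope.

(** * The spectral theorem for real symmetric matrices *)

Section RealSpectral.
Context {R : rcfType}.

Lemma row_normsq n (v : 'rV[R]_n) : (v *m v^T) 0 0 = \sum_i v 0 i ^+ 2.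
Proof. by rewrite mxE; apply: eq_bigr => i _; rewrite mxE expr2. Qed.

Lemma row_normsq_ge0 n (v : 'rV[R]_n) : 0 <= (v *m v^T) 0 0.
Proof. by rewrite row_normsq sumr_ge0 // => i _; apply: sqr_ge0. Qed.

Lemma row_normsq_eq0 n (v : 'rV[R]_n) : (v *m v^T) 0 0 = 0 -> v = 0.
Proof.
rewrite row_normsq => /psumr_eq0P v0; apply/rowP => i; rewrite mxE.
by apply/eqP; rewrite -sqrf_eq0 v0 // => j _; apply: sqr_ge0.
Qed.

(** Over the complex numbers the characteristic polynomial has a root. It is real because [A]
    becomes a Hermitian matrix, so it is already a root over [R]. *)
Lemma real_symmetric_eigenvalue n (A : 'M[R]_n.+1) :
  A^T = A -> exists a, eigenvalue A a.
Proof.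
move=> Asym; pose B := map_mx (real_complex R) A.
have [z Bz] : exists z, eigenvalue B z.
  have /closed_rootP [z Bz] : size (char_poly B) != 1%N by rewrite size_char_poly.
  by exists z; rewrite eigenvalue_root_char.
exists (complex.Re z); suff zr : z = real_complex R (complex.Re z).
  move: Bz; rewrite !eigenvalue_root_char {1}zr /B -map_char_poly.
  by rewrite fmorph_root.
case/eigenvalueP: Bz => v vB v0.
have Bsym : map_mx Num.conj B^T = B.
  by apply/matrixP=> i j; rewrite !mxE -[in RHS]Asym mxE conj_Creal // complex_real.
(* [v B v^*] is its own conjugate and equals [z * |v|^2]. *)
pose w := map_mx Num.conj v^T.
pose N := (v *m w) 0 0.
have NE : N = \sum_i `|v 0 i| ^+ 2.
  by rewrite /N mxE; apply: eq_bigr => i _; rewrite !mxE normCK.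
have Ngt0 : 0 < N.
  rewrite lt_def NE sumr_ge0 ?andbT => [|i _]; last by rewrite exprn_ge0.
  apply: contra v0; rewrite psumr_eq0 => [|i _]; last by rewrite exprn_ge0.
  move/allP => vi0; apply/eqP/rowP => i; rewrite mxE.
  by have := vi0 i (mem_index_enum i); rewrite /= expf_eq0 normr_eq0 => /eqP.
have zN : z * N = (v *m B *m w) 0 0 by rewrite vB -scalemxAl mxE.
have zNc : Num.conj (z * N) = z * N.
  rewrite zN -[in RHS]Bsym.
  have -> : v *m map_mx Num.conj B^T *m w = map_mx Num.conj (v *m B *m w)^T.
    rewrite !trmx_mul !map_mxM /= mulmxA.
    by congr (_ *m _ *m _); apply/matrixP=> i j; rewrite !mxE /= conjCK.
  by rewrite !mxE.
suff : z \is Num.real by case/complex_realP => x ->.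
rewrite CrealE; apply/eqP; move: zNc.
rewrite rmorphM /= (conj_Creal (gtr0_real Ngt0)).
by apply: mulIf; rewrite gt_eqF.
Qed.

(** Serves to carry the first basis vector [e] to a unit eigenvector [u], so that conjugation by [Q]
    splits off a block of size one. *)
Lemma householder n (u e : 'rV[R]_n) :
  u *m u^T = 1%:M -> e *m e^T = 1%:M ->
  exists2 Q : 'M_n, Q *m Q^T = 1%:M & e *m Q = u.
Proof.
move=> uu ee; pose w := u - e; pose c := (w *m w^T) 0 0; pose t := 2 / c.
have ww : w *m w^T = c%:M by rewrite [LHS]mx11_scalar.
have [c0|c0] := eqVneq c 0.
  exists 1%:M; first by rewrite trmx1 mulmx1.
  by rewrite mulmx1; apply/esym/subr0_eq/row_normsq_eq0.
(* The reflection exchanging [u] and [e]. *)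
pose H := 1%:M - t *: (w^T *m w).
have HT : H^T = H by rewrite /H linearB linearZ /= trmx1 trmx_mul trmxK.
exists H.
  have tc : t * c = 2 by rewrite /t divfK.
  (* Writing [K] for [t *: (w^T *m w)], the choice [t * c = 2] gives K^2 = 2K, so [H] = 1 - K
     squares to the identity. *)
  have KK : (t *: (w^T *m w)) *m (t *: (w^T *m w)) = (t *: (w^T *m w)) *+ 2.
    rewrite -scalemxAl -scalemxAr mulmxA -(mulmxA w^T) ww mul_mx_scalar -!scalemxAl.
    by rewrite [t *: (c *: _)]scalerA tc scalerA mulrC -scalerA scaler_nat.
  rewrite HT /H mulmxBr mulmx1 mulmxBl mul1mx KK mulr2n opprB.
  by rewrite addrK subrK.
pose s := (e *m u^T) 0 0.
have eu : e *m u^T = s%:M by rewrite [LHS]mx11_scalar.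
have ue : u *m e^T = s%:M by rewrite -[LHS]trmxK trmx_mul trmxK eu tr_scalar_mx.
(* As [u] and [e] are unit vectors, |u - e|^2 = 2 - 2s; this turns the coefficient [t * (s - 1)]
   below into -1. *)
have cE : c = 2 - 2 * s.
  have : w *m w^T = (2 - 2 * s)%:M.
    rewrite /w linearB mulmxBl !mulmxBr uu ee ue eu -!raddfB /=.
    by congr _%:M; ring.
  by move/matrixP/(_ 0 0); rewrite ww !mxE !mulr1n.
rewrite /H mulmxBr mulmx1 -scalemxAr mulmxA.
have -> : e *m w^T = (s - 1)%:M by rewrite /w linearB /= mulmxBr eu ee -raddfB.
rewrite mul_scalar_mx scalerA.
have -> : t * (s - 1) = -1 by rewrite /t; move: c0; rewrite cE => c0; field.
by rewrite scaleN1r opprK addrC subrK.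
Qed.

(** Induction on the dimension. After conjugation the eigenvector is the first basis vector, and
    symmetry clears both the first row and the first column off the diagonal. *)
Lemma real_symmetric_diagonalization n (A : 'M[R]_n) : A^T = A ->
  exists (Q : 'M_n) (D : 'rV_n), Q^T *m Q = 1%:M /\ A = Q *m diag_mx D *m Q^T.
Proof.
elim: n A => [|n IH] A Asym.
  by exists 0, 0; split; apply/matrixP=> [[]].
have [a /eigenvalueP[v vA v0]] := real_symmetric_eigenvalue Asym.
pose N := (v *m v^T) 0 0.
have N0 : 0 < N.
  rewrite lt_def row_normsq_ge0 andbT; apply: contra v0 => /eqP N0.
  exact/eqP/row_normsq_eq0.
pose u := (Num.sqrt N)^-1 *: v.
have uA : u *m A = a *: u by rewrite -scalemxAl vA !scalerA mulrC.
have uu : u *m u^T = 1%:M.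
  rewrite /u linearZ /= -scalemxAl -scalemxAr scalerA [v *m _]mx11_scalar -/N.
  rewrite scale_scalar_mx -invfM -expr2 sqr_sqrtr ?ltW //.
  by rewrite mulVf // gt_eqF.
pose e : 'rV[R]_(1 + n) := row_mx 1%:M 0.
have ee : e *m e^T = 1%:M by rewrite tr_row_mx mul_row_col trmx1 mulmx1 mul0mx addr0.
have [Q QQ eQ] := householder uu ee.
pose B : 'M[R]_(1 + n, 1 + n) := Q *m A *m Q^T.
have Bsym : B^T = B by rewrite !trmx_mul trmxK Asym mulmxA.
have eB : e *m B = a *: e by rewrite /B !mulmxA eQ uA -scalemxAl -eQ -mulmxA QQ mulmx1.
have BE : B = block_mx a%:M 0 0 (drsubmx B).
  have : row_mx (ulsubmx B) (ursubmx B) = row_mx a%:M 0.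
    move: eB; rewrite -{1}[B]submxK mul_row_block !mul1mx !mul0mx !addr0.
    by move->; rewrite scale_row_mx scaler0 scale_scalar_mx mulr1.
  case/eq_row_mx => Bul Bur.
  rewrite -{1}[B]submxK Bul Bur; congr block_mx.
  by rewrite -Bsym -trmx_ursub Bur trmx0.
have [|Q1 [D1 [QQ1 E1]]] := IH (drsubmx B); first by rewrite trmx_drsub Bsym.
pose T : 'M[R]_(1 + n) := block_mx 1%:M 0 0 Q1.
have TT : T^T *m T = 1%:M.
  rewrite tr_block_mx mulmx_block !trmx0 !mulmx0 !mul0mx trmx1 mulmx1 QQ1 !addr0 add0r.
  by rewrite -scalar_mx_block.
have QQ' := mulmx1C QQ.
exists (Q^T *m T), (row_mx a%:M D1); split.
  by rewrite trmx_mul trmxK mulmxA -(mulmxA _ Q) QQ mulmx1.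
rewrite trmx_mul trmxK mulmxA -(mulmxA _ T) -(mulmxA Q^T).
suff -> : T *m diag_mx (row_mx a%:M D1) *m T^T = B.
  by rewrite /B !mulmxA QQ' mul1mx -mulmxA QQ' mulmx1.
rewrite BE diag_mx_row tr_block_mx !mulmx_block !trmx0 !mulmx0 !mul0mx.
rewrite !(mulmx0, mul0mx, addr0, add0r, trmx1, mulmx1, mul1mx) E1; congr block_mx.
by apply/matrixP=> i j; rewrite !ord1 !mxE.
Qed.

(** Permuting the columns of [Q] lists the support [S] of [D] first; the rank is then the size of
    [S]. *)
Lemma real_symmetric_sorted_diagonalization n (A : 'M[R]_n) : A^T = A ->
  exists (Q : 'M_n) (D : 'rV_n), [/\ Q^T *m Q = 1%:M, A = Q *m diag_mx D *m Q^T
   & forall i : 'I_n, (D 0 i != 0) = (i < \rank A)%N].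
Proof.
move=> /real_symmetric_diagonalization[Q [D [QQ ->]]].
pose S := [set i | D 0 i != 0].
pose r := enum S ++ enum (~: S).
have sr : size r = n by rewrite size_cat -!cardE cardsC card_ord.
have ur : uniq r.
  rewrite cat_uniq !enum_uniq andbT /=; apply/hasPn => i.
  by rewrite !mem_enum inE.
(* The default [i] is never returned, since [r] has length [n]. *)
pose f (i : 'I_n) := nth i r i.
have finj : injective f.
  move=> i j /eqP; rewrite /f (set_nth_default j) ?sr //.
  by rewrite nth_uniq ?sr // => /eqP/val_inj.
pose s := perm finj.
have Ds i : (D 0 (s i) != 0) = (i < #|S|)%N.
  rewrite permE /f nth_cat -cardE; case: ifP => iS.
    by have := mem_nth i (_ : i < size (enum S))%N; rewrite mem_enum inE -cardE => ->.
  have : nth i (enum (~: S)) (i - #|S|) \in ~: S.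
    rewrite -mem_enum mem_nth // -cardE -subSn ?leq_subLR; last by rewrite leqNgt iS.
    by rewrite cardsC card_ord.
  by rewrite !inE negbK => ->.
pose Q' := col_perm s Q; pose D' := col_perm s D.
have QQ' : Q'^T *m Q' = 1%:M.
  apply/matrixP => i j; move/matrixP/(_ (s i) (s j)): QQ.
  rewrite !mxE (inj_eq perm_inj) => <-; apply: eq_bigr => k _; by rewrite !mxE.
have E : Q *m diag_mx D *m Q^T = Q' *m diag_mx D' *m Q'^T.
  apply/matrixP=> i j; rewrite !mul_mx_diag !mxE (reindex_inj (@perm_inj _ s)) /=.
  by apply: eq_bigr => k _; rewrite !mxE.
exists Q', D'; split => // i; rewrite mxE Ds; congr (_ < _)%N.
have uQ : Q' \in unitmx by have [] := mulmx1_unit QQ'.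
rewrite E mxrankMfree ?row_free_unit ?unitmx_tr //.
rewrite -mxrank_tr trmx_mul mxrankMfree ?row_free_unit ?unitmx_tr // tr_diag_mx.
(* Replacing the zero eigenvalues by 1 gives an invertible factor, so [diag_mx D'] has the rank of
   [pid_mx #|S|]. *)
pose T := \row_i (if (i < #|S|)%N then D' 0 i else 1).
have -> : diag_mx D' = diag_mx T *m pid_mx #|S|.
  apply/matrixP => k l; rewrite mul_diag_mx !mxE.
  have := Ds k; case: ltnP => _; last by move/negbFE/eqP->; rewrite mul0rn andbF mulr0.
  by rewrite andbT mulr_natr.
have uT : diag_mx T \in unitmx.
  rewrite unitmxE det_diag unitfE; apply/prodf_neq0 => k _; rewrite mxE.
  have := Ds k; case: ltnP => // [_|_]; first by rewrite mxE.
  by rewrite oner_eq0.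
rewrite -mxrank_tr trmx_mul mxrankMfree ?row_free_unit ?unitmx_tr // mxrank_tr.
by rewrite rank_pid_mx // -[X in (_ <= X)%N]card_ord max_card.
Qed.

End RealSpectral.

Local Open Scope classical_set_scope.

(** * The tangent space and compression to the kernel *)

Section TangentSpace.
Context {R : realType}.

Lemma tangent_block_sym n r (le_rn : (r <= n)%N) (U : 'M[R]_r) W :
  symm U -> (tangent_block le_rn U W)^T = tangent_block le_rn U W.
Proof. by move=> Us; rewrite /tangent_block trmx_cast /= tr_block_mx Us trmxK trmx0. Qed.

Lemma tangent_block_dr n r (le_rn : (r <= n)%N) (U : 'M[R]_r) W (i j : 'I_n) :
  (r <= i)%N -> (r <= j)%N -> tangent_block le_rn U W i j = 0.
Proof.
move=> ri rj; rewrite castmxE /= !mxE.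
case: splitP => [i' /= ii'|i' _]; first by have := ltn_ord i'; rewrite -ii' ltnNge ri.
rewrite !mxE; case: splitP => [j' /= jj'|j' _]; last by rewrite mxE.
by have := ltn_ord j'; rewrite -jj' ltnNge rj.
Qed.

(** Converse of the two preceding lemmas: together they replace the cast block matrices by symmetry
    and a vanishing condition on entries. *)
Lemma eq_tangent_block n r (le_rn : (r <= n)%N) (T : 'M[R]_n) :
  T^T = T -> (forall i j : 'I_n, (r <= i)%N -> (r <= j)%N -> T i j = 0) ->
  exists (U : 'M[R]_r) W, symm U /\ T = tangent_block le_rn U W.
Proof.
move=> Tsym T0; pose e := subnKC le_rn.
pose X := castmx (esym e, esym e) T.
have Xsym : X^T = X by rewrite /X trmx_cast /= Tsym.
exists (ulsubmx X), (ursubmx X); split; first by rewrite /symm /= trmx_ulsub Xsym.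
rewrite /tangent_block trmx_ursub Xsym.
have -> : 0 = drsubmx X.
  by apply/matrixP=> i j; rewrite !mxE castmxE T0 //= leq_addr.
by rewrite submxK /X castmxKV.
Qed.

Lemma real_spectral_decomposition n (M : 'M[R]_n) : M^T = M ->
  exists Q L, spectral_decomposition M Q L.
Proof.
move=> /real_symmetric_sorted_diagonalization[Q [D [QQ ME Dr]]]; exists Q, (diag_mx D).
by split=> // i; rewrite mxE eqxx mulr1n Dr.
Qed.

Variables (n d : nat) (M : 'M[R]_n) (P : 'M[R]_(n, d)).
Hypothesis Msym : M^T = M.
Hypothesis HP : cols_orthonormal_basis_of_ker M P.

(** In the eigenbasis the kernel vectors are the columns of [C]. From [L *m C = 0] they vanish on
    the first [\rank M] coordinates, so they meet only the zero block of [T]. *)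
Lemma tangent_space_compress0 Y : tangent_space M Y -> P^T *m Y *m P = 0.
Proof.
have MP : M *m P = 0.
  have [_ /andP[/sub_kermxP PM _]] := HP.
  by rewrite -[LHS]trmxK trmx_mul PM trmx0.
case=> Q [L [[QQ Ldiag Lr ME] [U [W [_ ->]]]]]; set T := tangent_block _ _ _.
pose C := Q^T *m P.
have LC : L *m C = 0.
  have <- : Q^T *m (M *m P) = L *m C by rewrite ME /C !mulmxA QQ mul1mx.
  by rewrite MP mulmx0.
have C0 (i : 'I_n) k : (i < \rank M)%N -> C i k = 0.
  rewrite -Lr => Li; move/matrixP/(_ i k): LC.
  rewrite [LHS]mxE [RHS]mxE (bigD1 i) //= big1 ?addr0.
    by move/eqP; rewrite mulf_eq0 (negbTE Li) => /eqP.
  by move=> j ji; rewrite (is_diag_mxP Ldiag) ?mul0r // eq_sym.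
have -> : P^T *m (Q *m T *m Q^T) *m P = C^T *m (T *m C).
  by rewrite /C trmx_mul trmxK !mulmxA.
apply/matrixP=> k l; rewrite mxE [RHS]mxE big1 // => i _; rewrite [C^T _ _]mxE.
have [ir|ri] := ltnP i (\rank M); first by rewrite C0 ?mul0r.
rewrite [(T *m C) i l]mxE big1 ?mulr0 // => j _.
have [jr|rj] := ltnP j (\rank M); first by rewrite C0 ?mulr0.
by rewrite tangent_block_dr ?mul0r.
Qed.

Lemma tangent_space_sym Y : tangent_space M Y -> Y^T = Y.
Proof.
case=> Q [L [_ [U [W [Us ->]]]]].
by rewrite !trmx_mul trmxK tangent_block_sym // mulmxA.
Qed.

(** The lower right block of [Q^T *m Y *m Q] pairs vectors of Ker M under [Y], hence is determined
    by [P^T *m Y *m P]. *)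
Lemma compress0_tangent_space Y : Y^T = Y -> P^T *m Y *m P = 0 -> tangent_space M Y.
Proof.
move=> Ysym PYP; have [Q [L QL]] := real_spectral_decomposition Msym.
exists Q, L; split; first exact: QL.
have [QQ Ldiag Lr ME] := QL.
have QQ' := mulmx1C QQ.
pose T := Q^T *m Y *m Q.
have YE : Y = Q *m T *m Q^T by rewrite /T !mulmxA QQ' mul1mx -mulmxA QQ' mulmx1.
(* The columns of [Q] past the rank have eigenvalue 0, hence are combinations of the columns of
   [P]. *)
have kerQ (i : 'I_n) : (\rank M <= i)%N -> exists c, row i Q^T = c *m P^T.
  move=> ri; apply/submxP; have [_ /andP[_]] := HP; apply: submx_trans.
  apply/sub_kermxP; rewrite -row_mul -trmx_mul ME -!mulmxA QQ mulmx1.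
  apply/rowP => k; rewrite !mxE big1 // => j _.
  have [<-|ji] := eqVneq i j; last by rewrite (is_diag_mxP Ldiag) ?mulr0 // eq_sym.
  by have := Lr i; rewrite ltnNge ri => /negbFE/eqP->; rewrite mulr0.
have Tdr (i j : 'I_n) : (\rank M <= i)%N -> (\rank M <= j)%N -> T i j = 0.
  move=> /kerQ[c ci] /kerQ[b bj].
  have -> : T i j = (row i Q^T *m Y *m (row j Q^T)^T) 0 0.
    by rewrite tr_row trmxK -!row_mul !mxE; apply: eq_bigr => k _; rewrite !mxE.
  by rewrite ci bj trmx_mul trmxK !mulmxA -(mulmxA c) -(mulmxA c) PYP mulmx0 mul0mx mxE.
have Tsym : T^T = T by rewrite !trmx_mul trmxK Ysym mulmxA.
have [U [W [Us TE]]] := eq_tangent_block (rank_leq_row M) Tsym Tdr.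
by exists U, W; rewrite -TE.
Qed.

End TangentSpace.

(** * Trace pairing with the matrices [Emx] and their span *)

Section Graph.
Context {R : realType}.
Variables (n d : nat) (E : rel 'I_n).
Hypothesis Esym : symmetric E.

Lemma VE_sym i j : VE E i j = VE E j i.
Proof. by rewrite /VE eq_sym Esym. Qed.

Lemma tr_Emx i j : (Emx i j)^T = Emx i j :> 'M[R]_n.
Proof. by rewrite linearZ linearD /= !trmx_delta addrC. Qed.

Lemma mxinner_Emx i j (X : 'M[R]_n) : X^T = X -> mxinner (Emx i j) X = X i j.
Proof.
move=> Xsym; rewrite /mxinner /Emx -scalemxAl mulmxDl mxtraceZ mxtraceD.
have tr_delta k l : \tr (delta_mx k l *m X) = X l k.
  rewrite /mxtrace (bigD1 k) //= big1 ?addr0 => [|i' ik].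
    rewrite mxE (bigD1 l) //= big1 ?addr0; first by rewrite mxE !eqxx mul1r.
    by move=> l' ll; rewrite mxE (negbTE ll) andbF mul0r.
  by rewrite mxE big1 // => l' _; rewrite mxE (negbTE ik) mul0r.
have Xji : X j i = X i j by rewrite -{1}Xsym mxE.
by rewrite !tr_delta Xji -mulr2n -[X i j *+ 2]mulr_natl mulKf ?pnatr_eq0.
Qed.

Lemma lin_VE_ind (Q : 'M[R]_n -> Prop) :
  Q 0 -> (forall X Y, Q X -> Q Y -> Q (X + Y)) -> (forall c X, Q X -> Q (c *: X)) ->
  (forall i j, VE E i j -> Q (Emx i j)) -> forall Z, Z \in lin_VE E -> Q Z.
Proof.
move=> Q0 QD QZ QE Z; rewrite /lin_VE.
set s := [seq _ | _ <- _] => /(@coord_span _ _ _ (in_tuple s)) ->.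
apply: big_ind => // k _; apply: QZ.
have : (in_tuple s)`_k \in s by rewrite mem_nth.
by case/mapP=> -[i j]; rewrite mem_enum inE => ij ->; apply: QE.
Qed.

Lemma lin_VE_sym (Z : 'M[R]_n) : Z \in lin_VE E -> Z^T = Z.
Proof.
move: Z; apply: lin_VE_ind => [|X Y XX YY|c X XX|i j _]; last exact: tr_Emx.
- by rewrite trmx0.
- by rewrite linearD /= XX YY.
- by rewrite linearZ /= XX.
Qed.

Lemma lin_VE_inner0 (X Z : 'M[R]_n) : X^T = X ->
  (forall i j, VE E i j -> X i j = 0) -> Z \in lin_VE E -> mxinner Z X = 0.
Proof.
move=> Xsym X0; move: Z; apply: lin_VE_ind => [|Y Z Y0 Z0|c Y Y0|i j ij].
- by rewrite /mxinner mul0mx mxtrace0.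
- by rewrite /mxinner mulmxDl mxtraceD [X in X + _]Y0 [X in _ + X]Z0 addr0.
- by rewrite /mxinner -scalemxAl mxtraceZ [X in _ * X]Y0 mulr0.
- by rewrite mxinner_Emx // X0.
Qed.

(** Averaging the expansion of [Z] in the [delta_mx i j] with its transpose expresses [Z] through
    the [Emx i j], summed over ordered pairs; the terms outside [VE E] vanish. *)
Lemma sym_lin_VE (Z : 'M[R]_n) : Z^T = Z ->
  (forall i j, ~~ VE E i j -> Z i j = 0) -> Z \in lin_VE E.
Proof.
move=> Zsym Z0.
have -> : Z = \sum_i \sum_j Z i j *: Emx i j.
  have ZE : Z = \sum_i \sum_j Z i j *: delta_mx i j := matrix_sum_delta Z.
  rewrite (eq_bigr (fun i => 2^-1 *: (\sum_j Z i j *: delta_mx i j +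
      (\sum_j Z i j *: delta_mx i j)^T))) => [|i _]; last first.
    rewrite linear_sum /= -big_split scaler_sumr; apply: eq_bigr => j _ /=.
    by rewrite [(_ *: _)^T]linearZ /= trmx_delta -scalerDr scalerA [RHS]scalerA mulrC.
  rewrite -scaler_sumr big_split /= -linear_sum /= -ZE Zsym -mulr2n -scaler_nat.
  by rewrite scalerA mulVf ?pnatr_eq0 // scale1r.
apply: memv_suml => i _; apply: memv_suml => j _.
have [ij|/Z0->] := boolP (VE E i j); last by rewrite scale0r mem0v.
apply/memvZ/memv_span/mapP; exists (i, j) => //.
by rewrite mem_enum inE.
Qed.

End Graph.

(** * Positive semidefinite matrices and bounds on quadratic forms *)

Section ExtremePoint.
Context {R : realType}.

Lemma addmxE m n (X Y : 'M[R]_(m, n)) i j : (X + Y) i j = X i j + Y i j.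
Proof. by rewrite mxE. Qed.

Lemma scalemxE m n c (X : 'M[R]_(m, n)) i j : (c *: X) i j = c * X i j.
Proof. by rewrite mxE. Qed.

(** Turns a linear functional on vectorised matrices into a trace pairing. *)
Lemma mxvec_inner m n (X Y : 'M[R]_(m, n)) :
  (mxvec X *m (mxvec Y)^T) 0 0 = \tr (X *m Y^T).
Proof.
rewrite mxE (reindex _ (curry_mxvec_bij m n)) /=.
transitivity (\sum_i \sum_j X i j * Y i j).
  by rewrite pair_bigA; apply: eq_bigr => -[i j] _ /=; rewrite mxE !mxvecE.
by apply: eq_bigr => i _; rewrite mxE; apply: eq_bigr => j _; rewrite mxE.
Qed.

(** With [y = Y *m x], the form at [x + s *: y] is nonnegative for every [s] and has no constant
    term, so its linear coefficient 2|y|^2 must vanish. *)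
Lemma psdmx_kernel n (Y : 'M[R]_n) (x : 'cV_n) :
  psdmx Y -> (x^T *m Y *m x) 0 0 = 0 -> Y *m x = 0.
Proof.
move=> [Ysym Yge0] xYx; pose y := Y *m x.
pose a := (y^T *m y) 0 0; pose b := (y^T *m Y *m y) 0 0.
have b0 : 0 <= b := Yge0 y.
have quad s : 0 <= 2 * s * a + s ^+ 2 * b.
  suff <- : ((x + s *: y)^T *m Y *m (x + s *: y)) 0 0 = 2 * s * a + s ^+ 2 * b by [].
  have xYy : (x^T *m Y *m y) 0 0 = a by rewrite /a {2}/y trmx_mul Ysym.
  have yYx : (y^T *m Y *m x) 0 0 = a by rewrite -mulmxA.
  rewrite [(x + _)^T]linearD /= [(s *: y)^T]linearZ /= !mulmxDl !mulmxDr -!scalemxAl -!scalemxAr.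
  by rewrite !(addmxE, scalemxE) xYx xYy yYx -/b; ring.
have : a = 0.
  apply/eqP; rewrite -sqrf_eq0 eq_le sqr_ge0 andbT.
  have b1 : 0 < b + 1 by rewrite ltr_wpDl.
  (* At this [s] the form is negative unless [a = 0]; using [b + 1] instead of [b] avoids a zero
     denominator. *)
  have := quad (- a / (b + 1)).
  have -> : 2 * (- a / (b + 1)) * a + (- a / (b + 1)) ^+ 2 * b =
      - (a ^+ 2 * ((b + 2) / (b + 1) ^+ 2)) by field; rewrite gt_eqF.
  rewrite oppr_ge0 pmulr_lle0 // divr_gt0 ?exprn_gt0 //.
  by rewrite ltr_wpDl.
by rewrite /a -{2}[y]trmxK => /row_normsq_eq0 y0; rewrite -/y -[y]trmxK y0 trmx0.
Qed.

(** Each product of coordinates satisfies |x_i x_j| <= |x|^2. The summand 1 in the constant keeps it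
    positive even for [S = 0]. *)
Lemma quad_form_bound n (S : 'M[R]_n) : exists2 c, 0 < c &
  forall x : 'cV_n, `|(x^T *m S *m x) 0 0| <= c * (x^T *m x) 0 0.
Proof.
exists (1 + \sum_i \sum_j `|S i j|) => [|x].
  by rewrite ltr_pwDl // sumr_ge0 // => i _; rewrite sumr_ge0.
have xx : (x^T *m x) 0 0 = \sum_i x i 0 ^+ 2.
  by rewrite mxE; apply: eq_bigr => i _; rewrite mxE expr2.
have xi i : x i 0 ^+ 2 <= (x^T *m x) 0 0.
  by rewrite xx (bigD1 i) //= lerDl sumr_ge0 // => j _; apply: sqr_ge0.
rewrite mulrDl mul1r ler_wpDl //.
  by rewrite xx sumr_ge0 // => j _; apply: sqr_ge0.
have -> : (x^T *m S *m x) 0 0 = \sum_i \sum_j S i j * (x i 0 * x j 0).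
  rewrite mxE exchange_big /=; apply: eq_bigr => j _; rewrite mxE mulr_suml.
  by apply: eq_bigr => i _; rewrite mxE; ring.
rewrite mulr_suml (le_trans (ler_norm_sum _ _ _)) // ler_sum // => i _.
rewrite mulr_suml (le_trans (ler_norm_sum _ _ _)) // ler_sum // => j _.
rewrite normrM ler_wpM2l //.
have := xi i; have := xi j; have := sqr_ge0 (x i 0 - x j 0).
have := sqr_ge0 (x i 0 + x j 0); rewrite ler_norml; nra.
Qed.

(** * The implications between the three assertions *)

Variables (n d : nat) (E : rel 'I_n) (M : 'M[R]_n) (P : 'M[R]_(n, d)).
Hypothesis Esym : symmetric E.
Hypothesis Msym : M^T = M.
Hypothesis HP : cols_orthonormal_basis_of_ker M P.

Lemma rowvec_form (S : 'M[R]_d) i j :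
  ((rowvec P i)^T *m S *m rowvec P j) 0 0 = (P *m S *m P^T) i j.
Proof.
by rewrite /rowvec trmxK tr_row -!row_mul !mxE; apply: eq_bigr => k _; rewrite !mxE.
Qed.

Lemma rowvec_dot i j : ((rowvec P i)^T *m rowvec P j) 0 0 = (P *m P^T) i j.
Proof. by rewrite -[_^T]mulmx1 rowvec_form mulmx1. Qed.

Lemma spectrahedronP (X : 'M[R]_n) : spectrahedron E P X <->
  psdmx X /\ forall i j, VE E i j -> X i j = (P *m P^T) i j.
Proof.
split=> -[Xpsd XE]; split=> // i j ij; have := XE i j ij;
  by rewrite rowvec_dot mxinner_Emx //; case: Xpsd.
Qed.

Let PP : P^T *m P = 1%:M := proj1 HP.

Lemma sandwichK (S : 'M[R]_d) : P^T *m (P *m S *m P^T) *m P = S.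
Proof. by rewrite !mulmxA PP mul1mx -mulmxA PP mulmx1. Qed.

Lemma sandwich_sym (S : 'M[R]_d) : S^T = S -> (P *m S *m P^T)^T = P *m S *m P^T.
Proof. by move=> Ss; rewrite !trmx_mul trmxK Ss mulmxA. Qed.

(** Assertion (iii) in matrix form: p_i^T S p_j is an entry of [P *m S *m P^T]. *)
Definition nondegenerate := forall S : 'M[R]_d, S^T = S ->
  (forall i j, VE E i j -> (P *m S *m P^T) i j = 0) -> S = 0.

(** The matrix [X] is orthogonal to both [tangent_space M] and [lin_VE E]. Splitting one factor of
    [X *m X] along their sum gives trace zero, that is, [X] has Frobenius norm 0. *)
Lemma SAP_nondegenerate : SAP E M -> nondegenerate.
Proof.
move=> sap S Ss S0; pose X := P *m S *m P^T.
have Xsym : X^T = X := sandwich_sym Ss.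
have : symm X by [].
rewrite -sap => -[Y TY [Z ZE YZ]].
have XX : \tr (X *m X) = 0.
  rewrite -{1}YZ mulmxDl mxtraceD [X in _ + X](lin_VE_inner0 Xsym S0 ZE) addr0.
  rewrite /X !mulmxA mxtrace_mulC !mulmxA.
  by rewrite (tangent_space_compress0 HP TY) mul0mx mxtrace0.
suff X0 : X = 0 by rewrite -[S]sandwichK -/X X0 mulmx0 mul0mx.
apply/row_matrixP => i; rewrite row0; apply: row_normsq_eq0.
have XXE : \tr (X *m X) = \sum_i (row i X *m (row i X)^T) 0 0.
  apply: eq_bigr => k _; rewrite -{2}Xsym tr_row -row_mul.
  by rewrite !mxE; apply: eq_bigr => l _; rewrite !mxE.
move: XX; rewrite XXE => /psumr_eq0P -> // k _; exact: row_normsq_ge0.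
Qed.

Lemma nondegenerate_extreme :
  nondegenerate -> extreme_point (spectrahedron E P) (P *m P^T).
Proof.
(* Only the first point of the segment is treated; the second follows by exchanging [t] and
   [1 - t]. *)
move=> nd; have Kuniq t (Y Z : 'M[R]_n) : spectrahedron E P Y ->
    spectrahedron E P Z -> 0 < t < 1 ->
    P *m P^T = t *: Y + (1 - t) *: Z -> Y = P *m P^T.
  move=> /spectrahedronP[Ypsd YE] /spectrahedronP[[_ Zge0] _] /andP[t0 t1] PPE.
  have [Ysym Yge0] := Ypsd.
  (* On Ker P^T the forms of [Y] and [Z] are nonnegative with a positively weighted sum equal to 0,
     so the form of [Y] is 0 there. *)
  have Yker (x : 'cV_n) : P^T *m x = 0 -> Y *m x = 0.
    move=> Px; apply: psdmx_kernel => //.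
    have : (x^T *m (P *m P^T) *m x) 0 0 = 0 by rewrite -!mulmxA Px !mulmx0 mxE.
    rewrite PPE mulmxDr mulmxDl -!scalemxAr -!scalemxAl.
    rewrite addmxE !scalemxE => /eqP.
    rewrite paddr_eq0 ?mulr_ge0 ?subr_ge0 ?(ltW t0) ?(ltW t1) //.
    by rewrite mulf_eq0 gt_eqF //= => /andP[/eqP].
  (* The columns of 1 - P P^T lie in Ker P^T, so [Y] kills them; with the transposed identity this
     gives Y = P P^T Y P P^T. *)
  have PN : P^T *m (1%:M - P *m P^T) = 0.
    by rewrite mulmxBr mulmx1 mulmxA PP mul1mx subrr.
  have YN : Y *m (1%:M - P *m P^T) = 0.
    apply/matrixP => i j; rewrite [RHS]mxE.
    have := Yker (col j (1%:M - P *m P^T)); rewrite colE !mulmxA PN mul0mx -colE.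
    by move=> /(_ erefl)/matrixP/(_ i 0); rewrite 2!mxE => ->; rewrite mxE.
  have YPP : Y = Y *m (P *m P^T).
    by apply/subr0_eq; rewrite -{1}[Y]mulmx1 -mulmxBr.
  have PPY : Y = P *m P^T *m Y.
    by rewrite -{1}Ysym {1}YPP !trmx_mul trmxK Ysym.
  pose S := P^T *m Y *m P - 1%:M.
  have SE : P *m S *m P^T = Y - P *m P^T.
    by rewrite /S mulmxBr mulmx1 mulmxBl !mulmxA -PPY -mulmxA -YPP.
  suff S0 : S = 0 by apply/subr0_eq; rewrite -SE S0 mulmx0 mul0mx.
  apply: nd; first by rewrite /S linearB /= !trmx_mul trmxK Ysym trmx1 mulmxA.
  by move=> i j ij; rewrite SE !mxE YE // mxE subrr.
split.
  apply/spectrahedronP; split=> //; split=> [|x]; first by rewrite trmx_mul trmxK.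
  have -> : x^T *m (P *m P^T) *m x = (x^T *m P) *m (x^T *m P)^T.
    by rewrite trmx_mul trmxK !mulmxA.
  exact: row_normsq_ge0.
move=> Y Z t KY KZ t01 PPE; split; first exact: (Kuniq t Y Z).
apply: (Kuniq (1 - t) Z Y) => //; last by rewrite PPE addrC opprB addrCA subrr addr0.
by case/andP: t01 => t0 t1; rewrite subr_gt0 t1 ltrBlDr ltrDl.
Qed.

(** [P *m P^T] is the midpoint of its perturbations by plus and minus [c^-1 *: (P *m S *m P^T)], so
    extremality forces them to coincide with it. *)
Lemma extreme_nondegenerate :
  extreme_point (spectrahedron E P) (P *m P^T) -> nondegenerate.
Proof.
move=> [_ ext] S Ss S0; have [c c0 Sc] := quad_form_bound S.
(* The condition on [s] covers both signs at once; dividing by the bound [c] keeps the perturbed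
   form nonnegative. *)
have perturb s : s ^+ 2 = 1 ->
    spectrahedron E P (P *m P^T + (s / c) *: (P *m S *m P^T)).
  move=> s1; apply/spectrahedronP; split; last first.
    by move=> i j ij; rewrite addmxE scalemxE S0 // mulr0 addr0.
  split=> [|x]; first by rewrite linearD linearZ /= sandwich_sym // trmx_mul trmxK.
  pose y := P^T *m x.
  have -> : x^T *m (P *m P^T + (s / c) *: (P *m S *m P^T)) *m x =
      y^T *m y + (s / c) *: (y^T *m S *m y).
    rewrite /y trmx_mul trmxK mulmxDr mulmxDl -scalemxAr -scalemxAl.
    by rewrite !mulmxA.
  have := Sc y; set q := (y^T *m S *m y) 0 0; set m := (y^T *m y) 0 0.
  rewrite ler_norml => /andP[q1 q2].
  rewrite addmxE scalemxE -/q -/m.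
  have -> : m + s / c * q = (c * m + s * q) / c by field; rewrite gt_eqF.
  rewrite divr_ge0 ?(ltW c0) //.
  move/eqP: s1; rewrite sqrf_eq1 => /orP[] /eqP ->; lra.
have s1 : (1 : R) ^+ 2 = 1 by rewrite expr1n.
have sN1 : (-1 : R) ^+ 2 = 1 by rewrite sqrrN expr1n.
have half : 0 < (2^-1 : R) < 1 by apply/andP; split; lra.
have [|YE _] := ext _ _ 2^-1 (perturb 1 s1) (perturb (-1) sN1) half.
  rewrite (_ : 1 - 2^-1 = 2^-1); last by lra.
  rewrite -scalerDr mulNr scaleNr addrACA subrr addr0 -mulr2n -scaler_nat.
  by rewrite scalerA mulVf ?scale1r ?pnatr_eq0.
have : P *m S *m P^T = 0.
  move/eqP: YE; rewrite -subr_eq0 addrAC subrr add0r scaler_eq0 mul1r invr_eq0.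
  by rewrite gt_eqF //= => /eqP.
by move=> X0; rewrite -[S]sandwichK X0 mulmx0 mul0mx.
Qed.

(* The projection of [Z + Z^T] onto [lin_VE E]. *)
Definition mask (Z : 'M[R]_n) : 'M[R]_n :=
  \matrix_(i, j) ((VE E i j)%:R * (Z i j + Z j i)).

Lemma mask_is_linear : linear mask.
Proof. by move=> a X Y; apply/matrixP=> i j; rewrite !mxE; ring. Qed.

HB.instance Definition _ :=
  GRing.isLinear.Build R 'M[R]_n 'M[R]_n *:%R mask mask_is_linear.

(** Compression to Ker M of elements of [lin_VE E]. As the tangent space is the kernel of
    compression on symmetric matrices, SAP amounts to this map reaching every symmetric matrix. *)
Definition compress_mask (Z : 'M[R]_n) : 'M[R]_d := P^T *m mask Z *m P.

Lemma compress_mask_is_linear : linear compress_mask.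
Proof.
move=> a X Y.
by rewrite /compress_mask linearP mulmxDr mulmxDl -scalemxAr -scalemxAl.
Qed.

HB.instance Definition _ :=
  GRing.isLinear.Build R 'M[R]_n 'M[R]_d *:%R compress_mask compress_mask_is_linear.

Lemma mask_lin_VE Z : mask Z \in lin_VE E.
Proof.
apply: sym_lin_VE => [|i j /negbTE ij]; last by rewrite mxE ij mul0r.
by apply/matrixP=> i j; rewrite !mxE VE_sym // addrC.
Qed.

(** Linear duality: a vector lies in the range of [A] once every column of [cokermx A] annihilates
    it. *)
Lemma compress_mask_onto (X : 'M[R]_d) :
  nondegenerate -> X^T = X -> exists Z, X = compress_mask Z.
Proof.
move=> nd Xsym; pose A := lin_mx compress_mask.
(* A functional vanishing on the range of [compress_mask] is [tr (_ C^T)], and on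
   symmetric matrices only [C + C^T] matters. *)
suff /submxP[u uA] : (mxvec X <= A)%MS.
  by exists (vec_mx u); rewrite -[X]mxvecK uA mul_rV_lin mxvecK.
rewrite submxE; apply/eqP/rowP => k; rewrite [RHS]mxE.
pose C := vec_mx (col k (cokermx A))^T.
have dotC (Y : 'M_d) : (mxvec Y *m cokermx A) 0 k = \tr (Y *m C^T).
  transitivity ((mxvec Y *m (mxvec C)^T) 0 0).
    by rewrite vec_mxK trmxK colE mulmxA -colE !mxE.
  by rewrite mxvec_inner.
have trS (Y : 'M_d) : Y^T = Y -> \tr (Y *m (C + C^T)) = 2 * \tr (Y *m C^T).
  move=> Ysym; rewrite mulmxDr mxtraceD -[\tr (Y *m C)]mxtrace_tr trmx_mul Ysym.
  by rewrite mxtrace_mulC -mulr2n mulr_natl.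
suff S0 : C + C^T = 0.
  have := trS X Xsym; rewrite S0 mulmx0 mxtrace0 dotC => /esym/eqP.
  by rewrite mulf_eq0 pnatr_eq0 => /eqP.
apply: nd => [|i j ij]; first by rewrite linearD /= trmxK addrC.
(* Testing on [delta_mx i j] for a pair in [VE E] reads off, by cyclicity of the trace, the entry at
   [i], [j] of [P *m (C + C^T) *m P^T]. *)
have maskE : mask (delta_mx i j) = 2 *: Emx i j.
  apply/matrixP=> p q; rewrite /Emx scalerA mulfV ?pnatr_eq0 // scale1r !mxE.
  rewrite [(q == i) && _]andbC; have [_|pq] := boolP (VE E p q); first by rewrite mul1r.
  rewrite mul0r; have [/andP[/eqP pi /eqP qj]|_] := boolP ((p == i) && _).
    by rewrite pi qj ij in pq.
  have [/andP[/eqP pj /eqP qi]|_] := boolP ((p == j) && _); last by rewrite addr0.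
  by rewrite pj qi VE_sym ?ij in pq.
have compress0 Z : \tr (compress_mask Z *m C^T) = 0.
  rewrite -dotC -[Z]mxvecK -mul_rV_lin -mulmxA mulmx_coker mulmx0.
  by rewrite mxE.
have := trS (compress_mask (delta_mx i j)).
rewrite compress0 mulr0 /compress_mask maskE => H.
have Dsym : (C + C^T)^T = C + C^T by rewrite linearD /= trmxK addrC.
move: H; rewrite !trmx_mul trmxK linearZ /= tr_Emx mulmxA => /(_ erefl).
rewrite -scalemxAr -!scalemxAl mxtraceZ => /eqP; rewrite mulf_eq0 pnatr_eq0 /= => /eqP H.
rewrite -(mxinner_Emx _ _ (sandwich_sym Dsym)) /mxinner -H -!mulmxA [RHS]mxtrace_mulC.
by rewrite !mulmxA.
Qed.

(** Some [mask Z] in [lin_VE E] has the same compression as [X]; the difference then compresses to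
    0, hence is tangent. *)
Lemma nondegenerate_SAP : nondegenerate -> SAP E M.
Proof.
move=> nd; apply/seteqP; split=> [_ [Y /tangent_space_sym Ysym [Z /lin_VE_sym Zsym <-]]|X Xsym].
  by rewrite /symm /= linearD /= Ysym Zsym.
have [|Z XZ] := @compress_mask_onto (P^T *m X *m P) nd.
  by rewrite !trmx_mul trmxK Xsym mulmxA.
exists (X - mask Z); last by exists (mask Z); rewrite ?subrK //; apply: mask_lin_VE.
apply: (compress0_tangent_space Msym HP).
  by rewrite linearB /= Xsym (lin_VE_sym (mask_lin_VE Z)).
by rewrite mulmxBr mulmxBl XZ subrr.
Qed.

End ExtremePoint.

Theorem theorem5p2 (R : realType) (n d : nat) (E : rel 'I_n)
    (Esym : symmetric E) (Eirr : irreflexive E)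
    (M : 'M[R]_n) (MCG : CG E M) (Mcorank : corank M = d)
    (P : 'M[R]_(n, d)) (HP : cols_orthonormal_basis_of_ker M P) :
  [<-> SAP E M;
       extreme_point (spectrahedron E P) (P *m P^T);
       forall S : 'M[R]_d, symm S ->
         (forall i j : 'I_n, VE E i j ->
            ((rowvec P i)^T *m S *m rowvec P j) 0 0 = 0) ->
         S = 0].
Proof.
have Msym : M^T = M := proj1 MCG.
have ndE : nondegenerate E P <-> forall S : 'M[R]_d, symm S ->
    (forall i j : 'I_n, VE E i j ->
       ((rowvec P i)^T *m S *m rowvec P j) 0 0 = 0) -> S = 0.
  split=> nd S Ss S0; apply: nd => // i j /S0; by rewrite rowvec_form.
(* The cycle (i) to (ii) to (iii) to (i), each step passing through [nondegenerate]. *)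
tfae.
- by move/(SAP_nondegenerate HP)/(nondegenerate_extreme HP).
- by move/(extreme_nondegenerate HP)/ndE.
- by move/ndE/(nondegenerate_SAP Esym Msym HP).
Qed.
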